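(* Let $n,m$ be positive even integers, let $M$ be a nonzero complex number, and let $\Lambda$ be a nonzero complex number (with a fixed square root $\sqrt{\Lambda}$) satisfying $$B'_{m+1}+\widetilde{B'_m}\,\widetilde{B_{n-1}}=0 .$$ Let $z_1,z_2,z_3$ be complex parameters, and let $(P_j),(Q_j),(P'_j),(Q'_j)$ be the sequences associated with $z_1,z_2,z_3,\Lambda,M$. Then an $M^2$-deformed solution $(z_1,\dots,z_{2n+2},z'_1,\dots,z'_{2m+2})$ for the $J(n,-m)$ knot is given by $$z_{2j-1}=\frac{P_{j-1}}{Q_{j+1}},\qquad z_{2j}=\frac{P_j}{Q_j},\qquad z'_{2j'-1}=\frac{P'_{j'-1}}{Q'_{j'+1}},\qquad z'_{2j'}=\frac{P'_{j'}}{Q'_{j'}}$$ for $1\le j\le n+1$ and $1\le j'\le m+1$ (for values of $z_1,z_2,z_3$ for which these quantities and the equations they are to satisfy are well defined and nondegenerate).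
   Context: **Tilde.** For a rational expression $P$ in $M$ (with coefficients possibly involving $\sqrt\Lambda$, regarded as independent of $M$), $\widetilde{P}$ is obtained from $P$ by replacing $M$ with $1/M$. **Sequences.** $(B_j)_{j\in\mathbb{Z}}$ is defined by $B_0=0$, $B_1=1$ and $$B_{j+1}=\sqrt{\Lambda}\,B_j+M^{2}B_{j-1}\ (j\text{ odd}),\qquad B_{j+1}=\sqrt{\Lambda}\,B_j+M^{-2}B_{j-1}\ (j\text{ even}).$$ $(P_j)_{j\in\mathbb{Z}}$ and $(Q_j)_{j\in\mathbb{Z}}$ satisfy the same recurrence as $B_j$ with initial conditions $P_0=z_1\left(z_2-\frac{z_3}{M^2}\right)$, $P_1=\sqrt{\Lambda}\,z_2z_3$, $Q_1=\sqrt{\Lambda}\,z_3$, $Q_2=z_2-\frac{z_3}{M^2}$. $(B'_j)_{j\in\mathbb{Z}}$ is defined by $B'_0=0$, $B'_1=1$ and $$B'_{j+1}=\left(\widetilde{B_{n+1}}-\widetilde{B_{n-1}}\right)B'_j+M^{-2}B'_{j-1}\ (j\text{ odd}),\qquad B'_{j+1}=\left(B_{n+1}-B_{n-1}\right)B'_j+M^{2}B'_{j-1}\ (j\text{ even}).$$ $(P'_j)_{j\in\mathbb{Z}}$ and $(Q'_j)_{j\in\mathbb{Z}}$ satisfy the same recurrence as $B'_j$ with initial conditions $P'_0=P_n$, $P'_1=P_0$, $Q'_1=Q_2$, $Q'_2=Q_{n+2}$. **Diagram and $M^2$-deformed solutions.** The knot $J(n,-m)$ ($n,m$ even) is the double twist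 knot with $n$ right-handed vertical crossings and $m$ left-handed horizontal crossings. In its standard alternating diagram, the $k$-th vertical crossing ($1\le k\le n$) has incident segments $z_{2k-1},z_{2k},z_{2k+1},z_{2k+2}$, and the $k$-th horizontal crossing ($1\le k\le m$) has incident segments $z'_{2k-1},z'_{2k},z'_{2k+1},z'_{2k+2}$; four segments are doubly labeled: $$z'_1=z_{2n+1},\qquad z'_2=z_1,\qquad z'_{2m+1}=z_{2n+2},\qquad z'_{2m+2}=z_2 .$$ For nonzero $a,b,c,d$ put $\Phi(a,b,c,d)=\mathrm{Li}_2(a/b)-\mathrm{Li}_2(a/c)+\mathrm{Li}_2(d/c)-\mathrm{Li}_2(d/b)$, where $\mathrm{Li}_2(z)=-\int_0^z\frac{\log(1-t)}{t}dt$. The potential function of the diagram, a function of the $2n+2m$ distinct segment variables, is $$V=\sum_{k=1}^{n}\Phi(z_{2k-1},z_{2k},z_{2k+1},z_{2k+2})-\sum_{k=1}^{m}\Phi(z'_{2k-1},z'_{2k},z'_{2k+1},z'_{2k+2}).$$ An $M^2$-deformed solution is a nondegenerate assignment of values to the segment variables (consistent with the double labels) satisfying the $M^2$-hyperbolicity equations: for every segment variable $y$, $$\exp\left(y\frac{\partial V}{\partial y}\right)=M^{2(-1)^j},$$ where $y=z_{2j-1}$ or $y=z_{2j}$ with $1\le j\le n+1$, or $y=z'_{2j-1}$ or $y=z'_{2j}$ with $1\le j\le m+1$ (the exponents agree for doubly labeled segments). Here $\exp(y\,\partial V/\partial y)$ is the rational function obtained using $\exp\left(y\,\partial_y\mathrm{Li}_2(y/c)\right)=(1-y/c)^{-1}$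 and $\exp\left(y\,\partial_y\mathrm{Li}_2(a/y)\right)=1-a/y$. For example, for $j$ even, $2\le j\le n$, the equation of $z_{2j-1}$ is $$\frac{z_{2j-1}-z_{2j}}{z_{2j-1}-z_{2j-3}}\cdot\frac{z_{2j}(z_{2j-1}-z_{2j+1})}{z_{2j+1}(z_{2j-1}-z_{2j})}=M^2 ,$$ and the equation of $z_1=z'_2$ is $$\frac{z_3(z'_2-z_2)}{z_2(z'_2-z_3)}\cdot\frac{z'_2-z'_1}{z'_2-z'_4}=M^2 .$$ The case of the orbifold of cone angle $2\pi/r$ corresponds to $M^2=e^{\pm 2\pi i/r}$. *)

(* Defs.v *)
From mathcomp Require Import all_boot all_order all_algebra.

Set Implicit Arguments.
Unset Strict Implicit.
Unset Printing Implicit Defensive.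

Import GRing.Theory.
Local Open Scope ring_scope.

(* Two-sided sequences X : int -> F with X_{j+1} = a_j X_j + b_j X_{j-1}. *)
Section TwoSidedRecurrence.
Variables (F : fieldType) (a b : int -> F) (k : int) (x y : F).

Definition satisfies_rec (X : int -> F) :=
  forall j : int, X (j + 1) = a j * X j + b j * X (j - 1).

(* rec_fwd i = (X_{k+i}, X_{k+i+1}) and rec_bwd i = (X_{k-i}, X_{k-i+1}) *)
Fixpoint rec_fwd (i : nat) : F * F :=
  if i is i'.+1 then
    let p := rec_fwd i' in
    (p.2, a (k + i'%:Z + 1) * p.2 + b (k + i'%:Z + 1) * p.1)
  else (x, y).

Fixpoint rec_bwd (i : nat) : F * F :=
  if i is i'.+1 then
    let p := rec_bwd i' in
    ((p.2 - a (k - i'%:Z) * p.1) / b (k - i'%:Z), p.1)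
  else (x, y).

(* The solution with X_k = x and X_{k+1} = y; see rec_sol_k, rec_sol_k1,
   rec_solP and rec_sol_unique. *)
Definition rec_sol (j : int) : F :=
  match j - k with
  | Posz i => (rec_fwd i).1
  | Negz i => (rec_bwd i.+1).1
  end.

Lemma rec_sol_k : rec_sol k = x.
Proof. by rewrite /rec_sol subrr. Qed.

Lemma rec_sol_k1 : rec_sol (k + 1) = y.
Proof. by rewrite /rec_sol; have -> : k + 1 - k = 1 by rewrite addrC addKr.
Qed.

Lemma rec_solP : (forall j, b j != 0) -> satisfies_rec rec_sol.
Proof.
move=> b0 j; have [d ->] : exists d, j = d + k.
  by exists (j - k); rewrite subrK.
rewrite /rec_sol [d + k + 1]addrAC [d + k - 1]addrAC !addrK.
case: d => [[|i]|[|i]].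
- have -> : 0%Z + k = k by rewrite add0r.
  rewrite /= subr0 [b k * _]mulrC.
  by rewrite divfK // [RHS]addrC subrK.
- have -> : i.+1%:Z - 1 = i by rewrite -addn1 PoszD addrK.
  have -> : i.+1%:Z + 1 = i.+2 by rewrite -[i.+2]addn1 PoszD.
  have -> : i.+1%:Z + k = k + i%:Z + 1 by rewrite addrC -addn1 PoszD addrA.
  by [].
- have -> : Negz 0 + 1 = 0 by [].
  have -> : Negz 0 - 1 = Negz 1 by [].
  have -> : Negz 0 + k = k - 1%:Z by rewrite addrC.
  by rewrite /= [b (k - 1) * _]mulrC divfK // [RHS]addrC subrK.
- have -> : Negz i.+1 + 1 = Negz i.
    by rewrite !NegzE -[i.+2]addn1 PoszD opprD subrK.
  have -> : Negz i.+1 - 1 = Negz i.+2.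
    by rewrite !NegzE -[i.+3]addn1 PoszD opprD.
  have -> : Negz i.+1 + k = k - i.+2%:Z by rewrite addrC.
  by rewrite /= [b (k - i.+2%:Z) * _]mulrC divfK // [RHS]addrC subrK.
Qed.

Lemma rec_sol_unique (X : int -> F) :
    (forall j, b j != 0) -> satisfies_rec X -> X k = x -> X (k + 1) = y ->
  X =1 rec_sol.
Proof.
move=> b0 XP Xk Xk1 j.
have fwd i : (X (k + i%:Z), X (k + i%:Z + 1)) = rec_fwd i.
  elim: i => [|i IH] /=; first by rewrite addr0 Xk Xk1.
  have -> : k + i.+1%:Z = k + i%:Z + 1 by rewrite -addn1 PoszD addrA.
  by rewrite -IH /= (XP (_ + 1)) addrK.
have bwd i : (X (k - i%:Z), X (k - i%:Z + 1)) = rec_bwd i.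
  elim: i => [|i IH] /=; first by rewrite subr0 Xk Xk1.
  have e : k - i.+1%:Z = k - i%:Z - 1 by rewrite -addn1 PoszD opprD addrA.
  rewrite -IH /= e subrK (XP (k - i%:Z)) (addrC (a _ * _)) addrK.
  by rewrite mulrC mulKf.
have -> : j = k + (j - k) by rewrite addrC subrK.
rewrite /rec_sol (addrC k) addrK addrC; case: (j - k) => i.
  by rewrite -fwd.
by rewrite NegzE -bwd.
Qed.

End TwoSidedRecurrence.

Section Sequences.
Variable F : fieldType.
Implicit Types (s M z : F) (n : nat) (j : int).

Definition oddz j : bool := odd `|j|%N.

Definition tilde (P : F -> F) : F -> F := fun M => P M^-1.

(* s stands for the fixed square root of Lambda. *)
Definition B_a s (j : int) : F := s.
Definition B_b M j : F := if oddz j then M ^+ 2 else M ^- 2.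

Definition B_seq s M : int -> F := rec_sol (B_a s) (B_b M) 0 0 1.

Definition P_seq s M z1 z2 z3 : int -> F :=
  rec_sol (B_a s) (B_b M) 0 (z1 * (z2 - z3 / M ^+ 2)) (s * z2 * z3).

Definition Q_seq s M z2 z3 : int -> F :=
  rec_sol (B_a s) (B_b M) 1 (s * z3) (z2 - z3 / M ^+ 2).

Definition B'_a s n M j : F :=
  if oddz j
  then tilde (fun M => B_seq s M (n%:Z + 1)) M
         - tilde (fun M => B_seq s M (n%:Z - 1)) M
  else B_seq s M (n%:Z + 1) - B_seq s M (n%:Z - 1).
Definition B'_b M j : F := if oddz j then M ^- 2 else M ^+ 2.

Definition B'_seq s n M : int -> F :=
  rec_sol (B'_a s n M) (B'_b M) 0 0 1.

Definition P'_seq s n M z1 z2 z3 : int -> F :=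
  rec_sol (B'_a s n M) (B'_b M) 0
    (P_seq s M z1 z2 z3 n%:Z) (P_seq s M z1 z2 z3 0).

Definition Q'_seq s n M z2 z3 : int -> F :=
  rec_sol (B'_a s n M) (B'_b M) 1
    (Q_seq s M z2 z3 2) (Q_seq s M z2 z3 (n%:Z + 2)).

End Sequences.

Section Diagram.
Variables n m : nat.

(* The vertical crossings of J(n,-m) are numbered 1..n and the horizontal ones
   1..m.  The distinct segment variables: inl k is z_k for 1 <= k <= 2n+2, and
   inr k is z'_k for 3 <= k <= 2m.  The labels z'_1, z'_2, z'_{2m+1} and
   z'_{2m+2} name segments which are already z-labeled. *)
Definition segment : eqType := (nat + nat)%type.

Definition zseg (k : nat) : segment := inl k.

Definition z'seg (k : nat) : segment :=
  if k == 1%N then inl (2 * n + 1)%N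
  else if k == 2%N then inl 1%N
  else if k == (2 * m + 1)%N then inl (2 * n + 2)%N
  else if k == (2 * m + 2)%N then inl 2%N
  else inr k.

(* A formal sum of dilogarithms: the triple (e, a, b) is e * Li_2(a/b). *)
Definition dilog_sum := seq (int * segment * segment).

Definition Phi (e : int) (a b c d : segment) : dilog_sum :=
  [:: (e, a, b); (- e, a, c); (e, d, c); (- e, d, b)].

Definition potential : dilog_sum :=
  flatten [seq Phi 1 (zseg (2 * k - 1)) (zseg (2 * k))
                     (zseg (2 * k + 1)) (zseg (2 * k + 2)) | k <- iota 1 n]
  ++
  flatten [seq Phi (- 1) (z'seg (2 * k - 1)) (z'seg (2 * k))
                     (z'seg (2 * k + 1)) (z'seg (2 * k + 2)) | k <- iota 1 m].

End Diagram.

Section Hyperbolicity.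
Variable F : fieldType.
Implicit Types (w : segment -> F) (z : nat -> F).

(* exp(y dV/dy) at w, using exp(y d/dy Li_2(y/c)) = (1 - y/c)^-1 and
   exp(y d/dy Li_2(a/y)) = 1 - a/y *)
Definition exp_ydV (V : dilog_sum) w (y : segment) : F :=
  \prod_(t <- V)
    let: (e, a, b) := t in
    (if y == a then (1 - w a / w b) ^ (- e) else 1) *
    (if y == b then (1 - w a / w b) ^ e else 1).

(* No argument of a dilogarithm in V is 0, 1 or infinity. *)
Definition nondegenerate_assignment (V : dilog_sum) w : Prop :=
  forall e a b, (e, a, b) \in V -> [/\ w a != 0, w b != 0 & w a != w b].

Definition consistent (n m : nat) z z' : Prop :=
  [/\ z' 1%N = z (2 * n + 1)%N, z' 2%N = z 1%N,
      z' (2 * m + 1)%N = z (2 * n + 2)%N & z' (2 * m + 2)%N = z 2%N].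

Definition assignment z z' : segment -> F :=
  fun y => match y with inl k => z k | inr k => z' k end.

Definition hyperbolicity_equation (n m : nat) (M : F) w (j : nat)
    (y : segment) : Prop :=
  exp_ydV (potential n m) w y = M ^ (2 * (- 1) ^+ j).

Definition deformed_solution (n m : nat) (M : F) z z' : Prop :=
  let w := assignment z z' in
  [/\ consistent n m z z',
      nondegenerate_assignment (potential n m) w,
      forall j, (1 <= j <= n + 1)%N ->
        hyperbolicity_equation n m M w j (zseg (2 * j - 1)) /\
        hyperbolicity_equation n m M w j (zseg (2 * j))
    & forall j, (1 <= j <= m + 1)%N ->
        hyperbolicity_equation n m M w j (z'seg n m (2 * j - 1)) /\
        hyperbolicity_equation n m M w j (z'seg n m (2 * j))].

End Hyperbolicity.

(* Main.v *)
Require Import Defs.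
From mathcomp Require Import all_boot all_order all_algebra.
From mathcomp Require Import reals complex.
From mathcomp Require Import ring zify.

Set Implicit Arguments.
Unset Strict Implicit.
Unset Printing Implicit Defensive.

Import GRing.Theory.
Local Open Scope ring_scope.

(** Each twist region of the diagram is governed by a pair of solutions X, Y
    ((P, Q) in the vertical region, (P', Q') in the horizontal one) of one
    recurrence X_(j+1) = a_j X_j + b_j X_(j-1), where a and b have period 2 and
    b_j b_(j+1) = 1.  Writing the segments of the k-th crossing as
    X_(k-1)/Y_(k+1), X_k/Y_k, X_k/Y_(k+2), X_(k+1)/Y_(k+1), the four differences
    1 - (ratio) that occur in the potential have the common denominator
    X_k Y_(k+1), and numerators G_k, -D_k, -G_(k+1), E_k, where
      D_k = X_(k-1) Y_(k+2) - X_k Y_(k+1),   E_k = X_k Y_(k+1) - X_(k+1) Y_k,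
      G_k = X_k Y_(k+1) - X_(k-1) Y_k.
    Hence the crossing contributes -D_k/G_k, G_k/E_k, G_(k+1)/D_k, -E_k/G_(k+1)
    to exp(y dV/dy) of its four segments (crossing_shares), or the inverses in
    the horizontal region, which enters V with a minus sign.  An interior
    segment meets two consecutive crossings of one region, the G's cancel, and
    what is left is -D_k/D_(k-1) or -E_(k-1)/E_k.  Both D and E are Casoratians,
    so they are multiplied by a value of -b at each step, and the equation holds
    whatever the initial values of X and Y are (twist_interior).

    The four corner segments meet one crossing of each region.  There the link
    between the regions matters: P', Q' start from values of P, Q, and the
    equation satisfied by Lambda makes them also end on values of P, Q.  The
    transfer matrix across a region is made of the fundamental solution B and of
    its tilde, which is the fundamental solution of the recurrence shifted by
    one step (rec_block).  Its determinant is 1 (fund_det), and for an even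
    number of crossings B and its tilde differ only by explicit factors
    (fund_even).  With beta = B_n, this gives two facts.  First, the end values
    (P'_m, Q'_(m+2)) are proportional to (P_(n+1), Q_(n+1)), and
    (P'_(m+1), Q'_(m+1)) to (P_1, Q_1); this is consistency of the doubly
    labeled segments (closing_up).  Second, the D, E, G of the horizontal region
    at its two ends are multiples of those of the vertical region by beta and
    powers of M^2 (corner_minors), so that all the minors cancel in the corner
    equations (twist_knot_solution). *)

(** * Two-term recurrences with period 2 *)

Lemma intSr (k : nat) : k.+1%:Z = k%:Z + 1.
Proof. by rewrite -addn1 PoszD. Qed.

Section PeriodicRecurrence.
Variables (F : fieldType) (a b : int -> F).
Hypothesis a_per : forall j, a (j + 1 + 1) = a j.
Hypothesis b_inv : forall j, b j * b (j + 1) = 1.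
Implicit Types (X Y : int -> F) (j : int) (k : nat).

Definition shift X j : F := X (j + 1).

Definition fund (c d : int -> F) : int -> F := rec_sol c d 0 0 1.

Local Notation K := (fund a b).
Local Notation K' := (fund (shift a) (shift b)).

Lemma rec_coef_neq0 j : b j != 0.
Proof.
by apply/eqP => b0; have/eqP := b_inv j; rewrite b0 mul0r eq_sym oner_eq0.
Qed.

Lemma rec_coef_per j : b (j + 1 + 1) = b j.
Proof.
by apply: (mulfI (rec_coef_neq0 (j + 1))); rewrite b_inv mulrC b_inv.
Qed.

Lemma fund0 c d : fund c d 0 = 0.
Proof. exact: rec_sol_k. Qed.

Lemma fund1 c d : fund c d 1 = 1.
Proof. exact: (rec_sol_k1 c d 0 0 1). Qed.

Lemma fund_rec : satisfies_rec a b K.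
Proof. exact/rec_solP/rec_coef_neq0. Qed.

Lemma fund_shift_rec : satisfies_rec (shift a) (shift b) K'.
Proof. by apply: rec_solP => j; apply: rec_coef_neq0. Qed.

Lemma fund_unshift_rec : satisfies_rec a b (fun j => K' (j - 1)).
Proof.
move=> j; have -> : j + 1 - 1 = j - 1 + 1 by rewrite addrAC.
by rewrite (fund_shift_rec (j - 1)) /shift subrK.
Qed.

Lemma fund_shiftN1 : b 1 * K' (0 - 1) = 1.
Proof.
by have := fund_shift_rec 0; rewrite fund0 fund1 mulr0 add0r.
Qed.

(** The basis of solutions is K, with values (0, 1) at (0, 1), and
    b_1 K'_(j-1), with values (1, 0). *)
Lemma rec_transfer X j : satisfies_rec a b X ->
  X j = K j * X 1 + b 1 * K' (j - 1) * X 0.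
Proof.
move=> XP.
rewrite (rec_sol_unique (k := 0) rec_coef_neq0 XP erefl erefl j).
apply/esym; apply: (rec_sol_unique rec_coef_neq0
  (X := fun i => K i * X 1 + b 1 * K' (i - 1) * X 0)).
- by move=> i; rewrite fund_rec (fund_unshift_rec i); ring.
- by rewrite fund0 fund_shiftN1; ring.
- by rewrite add0r fund1 subrr fund0; ring.
Qed.

Lemma shift_rec X : satisfies_rec a b X ->
  satisfies_rec (shift a) (shift b) (shift X).
Proof. by move=> XP j; rewrite /shift XP addrK subrK. Qed.

Definition casoratian X Y j := X j * Y (j + 1) - X (j + 1) * Y j.

(** As a and b have period 2, j |-> Y_(j+2) solves the recurrence of Y, so this
    is the Casoratian, at index j - 1, of X and of Y moved by two steps. *)
Definition lagged_casoratian X Y j :=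
  X (j - 1) * Y (j + 1 + 1) - X j * Y (j + 1).

Lemma casoratian_step X Y j : satisfies_rec a b X -> satisfies_rec a b Y ->
  casoratian X Y (j + 1) = - b (j + 1) * casoratian X Y j.
Proof.
by move=> XP YP; rewrite /casoratian (XP (j + 1)) (YP (j + 1)) addrK; ring.
Qed.

Lemma lagged_casoratian_step X Y j :
    satisfies_rec a b X -> satisfies_rec a b Y ->
  lagged_casoratian X Y (j + 1) = - b j * lagged_casoratian X Y j.
Proof.
move=> XP YP; rewrite /lagged_casoratian addrK (XP j) (YP (j + 1 + 1)) addrK.
by rewrite a_per rec_coef_per; ring.
Qed.

Lemma int_double_succ j k : j + k.+1.*2%:Z = j + k.*2%:Z + 1 + 1.
Proof. by rewrite doubleS -addn2 PoszD; ring. Qed.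

(** Over a full period the factors -b_j and -b_(j+1) multiply to 1. *)
Lemma casoratian_even X Y k j : satisfies_rec a b X -> satisfies_rec a b Y ->
  casoratian X Y (j + k.*2%:Z) = casoratian X Y j.
Proof.
move=> XP YP; elim: k => [|k IH]; first by rewrite addr0.
rewrite int_double_succ !casoratian_step // IH -[RHS]mul1r.
by rewrite -(b_inv (j + k.*2%:Z + 1)); ring.
Qed.

Lemma lagged_casoratian_even X Y k j :
    satisfies_rec a b X -> satisfies_rec a b Y ->
  lagged_casoratian X Y (j + k.*2%:Z) = lagged_casoratian X Y j.
Proof.
move=> XP YP; elim: k => [|k IH]; first by rewrite addr0.
rewrite int_double_succ !lagged_casoratian_step // IH -[RHS]mul1r.
by rewrite -(b_inv (j + k.*2%:Z)); ring.
Qed.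

(** The transfer matrix over an even number of steps has determinant 1; this is
    the invariance of the Casoratian of the basis of rec_transfer. *)
Lemma fund_det k :
  K' (k.*2%:Z - 1) * K (k.*2%:Z + 1) = K k.*2%:Z * K' k.*2%:Z + b 0.
Proof.
apply: (addIr (- (K k.*2%:Z * K' k.*2%:Z))); rewrite [RHS]addrAC subrr add0r.
have := casoratian_even k 0 fund_unshift_rec fund_rec.
rewrite /casoratian !add0r addrK subrr !fund0 fund1 mulr1 mul0r subr0.
rewrite (mulrC (K _)) => ->; apply: (mulfI (rec_coef_neq0 1)).
by rewrite -[X in _ = X]mulrC (b_inv 0) -[in LHS](add0r (- 1)) fund_shiftN1.
Qed.

Lemma per_double (c : int -> F) k j : (forall i, c (i + 1 + 1) = c i) ->
  c (k.*2%:Z + j) = c j.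
Proof.
move=> cP; rewrite addrC; elim: k => [|k IH]; first by rewrite addr0.
by rewrite int_double_succ cP.
Qed.

(** The first two relations do not carry an induction by themselves: the
    cofactor at the next even index has one expression from each sequence, and
    the third relation is what makes the two agree. *)
Lemma fund_even k : exists g,
  [/\ K k.*2%:Z = a 1 * g, K' k.*2%:Z = a 0 * g &
      K (k.*2%:Z + 1) - K' (k.*2%:Z + 1) = (b 0 - b 1) * g].
Proof.
elim: k => [|k [g [e1 e2 e3]]].
  by exists 0; rewrite !add0r !fund0 !fund1; split; ring.
have pa j : a (k.*2%:Z + j) = a j by apply: per_double.
have pb j : b (k.*2%:Z + j) = b j by apply: per_double rec_coef_per.
have pa0 : a k.*2%:Z = a 0 by rewrite -(pa 0) addr0.
have pb0 : b k.*2%:Z = b 0 by rewrite -(pb 0) addr0.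
set h := K (k.*2%:Z + 1) + b 1 * g; exists h.
have hE : h = K' (k.*2%:Z + 1) + b 0 * g.
  by rewrite /h -[K _](subrK (K' (k.*2%:Z + 1))) e3; ring.
rewrite -(add0r k.+1.*2%:Z) int_double_succ add0r.
have f1 : K (k.*2%:Z + 1 + 1) = a 1 * h.
  by rewrite (fund_rec (_ + 1)) addrK pa pb e1 /h; ring.
have f2 : K' (k.*2%:Z + 1 + 1) = a 0 * h.
  rewrite (fund_shift_rec (_ + 1)) addrK /shift a_per rec_coef_per pa0 pb0 e2.
  by rewrite hE; ring.
split=> //; rewrite (fund_rec (_ + 1 + 1)) (fund_shift_rec (_ + 1 + 1)) !addrK.
rewrite /shift !a_per !rec_coef_per pa pb pa0 pb0 f1 f2.
have -> : K (k.*2%:Z + 1) = h - b 1 * g by rewrite /h; ring.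
have -> : K' (k.*2%:Z + 1) = h - b 0 * g by rewrite hE; ring.
ring.
Qed.

End PeriodicRecurrence.

Section TransferBlocks.
Variables (F : fieldType) (a b : int -> F).
Hypothesis a_per : forall j, a (j + 1 + 1) = a j.
Hypothesis b_inv : forall j, b j * b (j + 1) = 1.
Implicit Types (X : int -> F) (k : nat).

Lemma rec_sol_ext (c d : int -> F) i x y : a =1 c -> b =1 d ->
  rec_sol a b i x y =1 rec_sol c d i x y.
Proof.
move=> ac bd; have b0 := rec_coef_neq0 b_inv.
apply: rec_sol_unique => [j||//|]; first by rewrite -bd.
- by move=> j; rewrite -ac -bd; apply: rec_solP.
- exact: rec_sol_k.
- exact: rec_sol_k1.
Qed.

Lemma shift_inv j : shift b j * shift b (j + 1) = 1.
Proof. exact: b_inv. Qed.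

(** Applying the tilde twice gives back the original sequence. *)
Lemma fund_shift2 : fund (shift (shift a)) (shift (shift b)) =1 fund a b.
Proof.
move=> j; apply/esym/rec_sol_ext => i; rewrite /shift ?a_per //.
by rewrite (rec_coef_per b_inv).
Qed.

Local Notation K := (fund a b).
Local Notation K' := (fund (shift a) (shift b)).

(** Two ways to transport a solution across N steps: from (X_0, X_1), and from
    (X_1, X_2), which are the initial data of P and Q respectively. *)
Lemma rec_block X (N : int) : satisfies_rec a b X ->
  [/\ X N = K N * X 1 + b 1 * K' (N - 1) * X 0,
      X (N + 1) = K (N + 1) * X 1 + b 1 * K' N * X 0,
      X (N + 1) = K' N * X 2 + b 0 * K (N - 1) * X 1 &
      X (N + 2) = K' (N + 1) * X 2 + b 0 * K N * X 1].
Proof.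
move=> XP; have X'P := shift_rec XP.
have b2 : shift b 1 = b 0 by rewrite -(rec_coef_per b_inv 0).
split; first exact: rec_transfer.
- by rewrite (rec_transfer b_inv _ XP) addrK.
- by have := rec_transfer shift_inv N X'P; rewrite fund_shift2 b2.
- have := rec_transfer shift_inv (N + 1) X'P; rewrite fund_shift2 b2 addrK.
  by rewrite {1}/shift -addrA.
Qed.

(** An even index is one step short of a full number of periods after 1. *)
Lemma minors_even X Y k : satisfies_rec a b X -> satisfies_rec a b Y ->
  lagged_casoratian X Y k.*2%:Z = - b 1 * lagged_casoratian X Y 1 /\
  casoratian X Y k.*2%:Z = - b 0 * casoratian X Y 1.
Proof.
move=> XP YP.
have bk : b k.*2%:Z = b 0.
  by rewrite -(per_double k 0 (rec_coef_per b_inv)) addr0.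
have bk1 : b (k.*2%:Z + 1) = b 1.
  by rewrite (per_double k 1 (rec_coef_per b_inv)).
have b01 : b 0 * b 1 = 1 := b_inv 0.
have := lagged_casoratian_step a_per b_inv k.*2%:Z XP YP.
have := casoratian_step k.*2%:Z XP YP.
rewrite (addrC _ 1) (casoratian_even b_inv k 1 XP YP).
rewrite (lagged_casoratian_even a_per b_inv k 1 XP YP) (addrC 1) bk bk1.
move=> -> ->.
by split; rewrite mulrA mulrNN ?b01 ?[b 1 * _]mulrC ?b01 mul1r.
Qed.

End TransferBlocks.

(** * Contributions of the crossings of a twist region *)

Section Twist.
Variable F : fieldType.
Implicit Types (w : segment -> F) (g : nat -> segment).

Definition twist e g (N : nat) : dilog_sum :=
  flatten [seq Phi e (g (2 * k - 1)%N) (g (2 * k)%N)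
                     (g (2 * k + 1)%N) (g (2 * k + 2)%N) | k <- iota 1 N].

Lemma potential_twist n m :
  potential n m = twist 1 zseg n ++ twist (- 1) (z'seg n m) m.
Proof. by []. Qed.

(** In Phi(a, b, c, d) the variables a and d only occur as numerators of the
    dilogarithms, b and c only as denominators.  The two functions give the
    factor of exp(y dV/dy) coming from one crossing, for y a numerator x with
    denominators y, z, and for y a denominator z with numerators x, y. *)
Definition numer_share (x y z : F) := (1 - x / z) / (1 - x / y).
Definition denom_share (x y z : F) := (1 - x / z) / (1 - y / z).

Lemma exp_ydV_cat (V W : dilog_sum) w y :
  exp_ydV (V ++ W) w y = exp_ydV V w y * exp_ydV W w y.
Proof. exact: big_cat. Qed.

Lemma exp_ydV_Phi e a b c d w y :
  exp_ydV (Phi e a b c d) w y =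
  (if y == a then numer_share (w a) (w b) (w c) ^ e else 1)
  * (if y == b then denom_share (w a) (w d) (w b) ^ e else 1)
  * (if y == c then denom_share (w d) (w a) (w c) ^ e else 1)
  * (if y == d then numer_share (w d) (w c) (w b) ^ e else 1).
Proof.
rewrite /exp_ydV /Phi /numer_share /denom_share !big_cons big_nil opprK.
rewrite !expfzMl !exprz_inv.
by case: (y == a); case: (y == b); case: (y == c); case: (y == d); ring.
Qed.

(** Separating the four roles of a segment in a crossing leaves products in
    which at most one crossing counts. *)
Lemma exp_ydV_twist e g N w y :
  exp_ydV (twist e g N) w y =
  \prod_(k <- iota 1 N | y == g (2 * k - 1)%N)
     numer_share (w (g (2 * k - 1)%N)) (w (g (2 * k)%N))
       (w (g (2 * k + 1)%N)) ^ e
  * \prod_(k <- iota 1 N | y == g (2 * k)%N)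
     denom_share (w (g (2 * k - 1)%N)) (w (g (2 * k + 2)%N))
       (w (g (2 * k)%N)) ^ e
  * \prod_(k <- iota 1 N | y == g (2 * k + 1)%N)
     denom_share (w (g (2 * k + 2)%N)) (w (g (2 * k - 1)%N))
       (w (g (2 * k + 1)%N)) ^ e
  * \prod_(k <- iota 1 N | y == g (2 * k + 2)%N)
     numer_share (w (g (2 * k + 2)%N)) (w (g (2 * k + 1)%N))
       (w (g (2 * k)%N)) ^ e.
Proof.
have -> : exp_ydV (twist e g N) w y = \prod_(k <- iota 1 N)
   exp_ydV (Phi e (g (2 * k - 1)%N) (g (2 * k)%N)
                     (g (2 * k + 1)%N) (g (2 * k + 2)%N)) w y.
  by rewrite /exp_ydV big_flatten big_map.
under eq_bigr do rewrite exp_ydV_Phi.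
by rewrite !big_split -!big_mkcond.
Qed.

Lemma exp_ydV_twist_out e g N w y :
  (forall i, (1 <= i <= 2 * N + 2)%N -> y != g i) ->
  exp_ydV (twist e g N) w y = 1.
Proof.
move=> yg; rewrite exp_ydV_twist !big1_seq ?mulr1 // => k /andP[/eqP yE];
  rewrite mem_iota => kN.
- by have /yg : (1 <= 2 * k + 2 <= 2 * N + 2)%N by [lia]; rewrite -yE eqxx.
- by have /yg : (1 <= 2 * k + 1 <= 2 * N + 2)%N by [lia]; rewrite -yE eqxx.
- by have /yg : (1 <= 2 * k <= 2 * N + 2)%N by [lia]; rewrite -yE eqxx.
- by have /yg : (1 <= 2 * k - 1 <= 2 * N + 2)%N by [lia]; rewrite -yE eqxx.
Qed.

Lemma prod_iota_pred (f : nat -> F) (P : pred nat) j N :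
  (forall k, (0 < k)%N -> P k = (k == j)) ->
  \prod_(k <- iota 1 N | P k) f k = if (1 <= j <= N)%N then f j else 1.
Proof.
move=> PE; have -> : \prod_(k <- iota 1 N | P k) f k =
    \prod_(k <- iota 1 N | k == j) f k.
  rewrite big_seq_cond [RHS]big_seq_cond; apply: eq_bigl => k.
  by rewrite mem_iota; case: ltnP => //= k0; rewrite PE.
case: ifP => jN.
  rewrite -big_filter filter_pred1_uniq ?iota_uniq ?big_seq1 // mem_iota.
  by lia.
by rewrite big1_seq // => k /andP[/eqP-> ]; rewrite mem_iota; lia.
Qed.

Lemma exp_ydV_twist_odd e g N w j : injective g -> (0 < j)%N ->
  exp_ydV (twist e g N) w (g (2 * j - 1)%N) =
  (if (1 <= j <= N)%N then
       numer_share (w (g (2 * j - 1)%N)) (w (g (2 * j)%N))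
         (w (g (2 * j + 1)%N)) ^ e
     else 1)
  * (if (1 <= j.-1 <= N)%N then
       denom_share (w (g (2 * j)%N)) (w (g (2 * j.-1 - 1)%N))
         (w (g (2 * j - 1)%N)) ^ e
     else 1).
Proof.
move=> gi j0; rewrite exp_ydV_twist (@prod_iota_pred _ _ j);
  last by move=> k k0; rewrite (inj_eq gi); lia.
rewrite (@prod_iota_pred _ (fun k => _ == g (2 * k)%N) 0%N);
  last by move=> k k0; rewrite (inj_eq gi); lia.
rewrite (@prod_iota_pred _ (fun k => _ == g (2 * k + 1)%N) j.-1);
  last by move=> k k0; rewrite (inj_eq gi); lia.
rewrite (@prod_iota_pred _ (fun k => _ == g (2 * k + 2)%N) 0%N);
  last by move=> k k0; rewrite (inj_eq gi); lia.
rewrite !mulr1; congr (_ * _); case: ifP => // jN.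
have -> : (2 * j.-1 + 2 = 2 * j)%N by lia.
by have -> : (2 * j.-1 + 1 = 2 * j - 1)%N by lia.
Qed.

Lemma exp_ydV_twist_even e g N w j : injective g -> (0 < j)%N ->
  exp_ydV (twist e g N) w (g (2 * j)%N) =
  (if (1 <= j <= N)%N then
       denom_share (w (g (2 * j - 1)%N)) (w (g (2 * j + 2)%N))
         (w (g (2 * j)%N)) ^ e
     else 1)
  * (if (1 <= j.-1 <= N)%N then
       numer_share (w (g (2 * j)%N)) (w (g (2 * j - 1)%N))
         (w (g (2 * j.-1)%N)) ^ e
     else 1).
Proof.
move=> gi j0; rewrite exp_ydV_twist (@prod_iota_pred _ _ 0%N);
  last by move=> k k0; rewrite (inj_eq gi); lia.
rewrite (@prod_iota_pred _ (fun k => _ == g (2 * k)%N) j);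
  last by move=> k k0; rewrite (inj_eq gi); lia.
rewrite (@prod_iota_pred _ (fun k => _ == g (2 * k + 1)%N) 0%N);
  last by move=> k k0; rewrite (inj_eq gi); lia.
rewrite (@prod_iota_pred _ (fun k => _ == g (2 * k + 2)%N) j.-1);
  last by move=> k k0; rewrite (inj_eq gi); lia.
rewrite !mulr1 mul1r; congr (_ * _); case: ifP => // jN.
have -> : (2 * j.-1 + 2 = 2 * j)%N by lia.
by have -> : (2 * j.-1 + 1 = 2 * j - 1)%N by lia.
Qed.

End Twist.

Section TwistRegion.
Variables (F : fieldType) (a b : int -> F).
Hypothesis a_per : forall j, a (j + 1 + 1) = a j.
Hypothesis b_inv : forall j, b j * b (j + 1) = 1.
Variables (P Q : int -> F).
Hypotheses (P_rec : satisfies_rec a b P) (Q_rec : satisfies_rec a b Q).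
Variables (e : int) (g : nat -> segment) (N : nat) (w : segment -> F).
Hypothesis g_inj : injective g.
Hypothesis w_g : forall j : nat, (1 <= j <= N + 1)%N ->
  w (g (2 * j - 1)%N) = P (j%:Z - 1) / Q (j%:Z + 1) /\
  w (g (2 * j)%N) = P j%:Z / Q j%:Z.
Hypothesis Q_neq0 : forall j : nat, (1 <= j <= N + 2)%N -> Q j%:Z != 0.
Hypothesis w_nondeg : nondegenerate_assignment (twist e g N) w.

(** Unlike the two Casoratians, this minor obeys no two-term relation, but it
    occurs in the contributions of two consecutive crossings and cancels. *)
Definition staggered_minor (X Y : int -> F) (j : int) :=
  X j * Y (j + 1) - X (j - 1) * Y j.

Local Notation D := (lagged_casoratian P Q).
Local Notation E := (casoratian P Q).
Local Notation G := (staggered_minor P Q).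

Lemma crossing_neq (k : nat) : (1 <= k <= N)%N ->
  [/\ w (g (2 * k)%N) != 0,
      w (g (2 * k - 1)%N) != w (g (2 * k)%N),
      w (g (2 * k - 1)%N) != w (g (2 * k + 1)%N),
      w (g (2 * k + 2)%N) != w (g (2 * k + 1)%N) &
      w (g (2 * k + 2)%N) != w (g (2 * k)%N)].
Proof.
move=> kN; have kP t : t \in Phi e (g (2 * k - 1)%N) (g (2 * k)%N)
    (g (2 * k + 1)%N) (g (2 * k + 2)%N) -> t \in twist e g N.
  by move=> tk; apply/flatten_mapP; exists k; rewrite // mem_iota; lia.
have [] := w_nondeg (kP (e, g (2 * k - 1)%N, g (2 * k)%N) _).
  by rewrite !inE eqxx.
move=> _ -> ->.
have [] := w_nondeg (kP (- e, g (2 * k - 1)%N, g (2 * k + 1)%N) _).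
  by rewrite !inE eqxx orbT.
move=> _ _ ->.
have [] := w_nondeg (kP (e, g (2 * k + 2)%N, g (2 * k + 1)%N) _).
  by rewrite !inE eqxx !orbT.
move=> _ _ ->.
have [] := w_nondeg (kP (- e, g (2 * k + 2)%N, g (2 * k)%N) _).
  by rewrite !inE eqxx !orbT.
by move=> _ _ ->.
Qed.

(** The four differences of the crossing share one denominator, which therefore
    disappears from every contribution. *)
Lemma crossing_differences (k : nat) : (1 <= k <= N)%N ->
  [/\ P k%:Z * Q (k%:Z + 1) != 0,
      1 - w (g (2 * k - 1)%N) / w (g (2 * k)%N)
        = G k%:Z / (P k%:Z * Q (k%:Z + 1)),
      1 - w (g (2 * k - 1)%N) / w (g (2 * k + 1)%N)
        = - D k%:Z / (P k%:Z * Q (k%:Z + 1)),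
      1 - w (g (2 * k + 2)%N) / w (g (2 * k + 1)%N)
        = - G (k%:Z + 1) / (P k%:Z * Q (k%:Z + 1)) &
      1 - w (g (2 * k + 2)%N) / w (g (2 * k)%N)
        = E k%:Z / (P k%:Z * Q (k%:Z + 1))].
Proof.
move=> kN; have [w0 _ _ _ _] := crossing_neq kN.
have kN1 : (1 <= k <= N + 1)%N by lia.
have kN2 : (1 <= k.+1 <= N + 1)%N by lia.
have [wa wb] := w_g kN1; have := w_g kN2.
have -> : (2 * k.+1 - 1 = 2 * k + 1)%N by lia.
have -> : (2 * k.+1 = 2 * k + 2)%N by lia.
rewrite intSr addrK => -[wc wd].
have q0 : Q k%:Z != 0 by apply: Q_neq0; lia.
have q1 : Q (k%:Z + 1) != 0.
  by rewrite -intSr; apply: Q_neq0; lia.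
have q2 : Q (k%:Z + 1 + 1) != 0.
  by rewrite -!intSr; apply: Q_neq0; lia.
have p1 : P k%:Z != 0 by move: w0; rewrite wb mulf_eq0 negb_or => /andP[].
rewrite wa wb wc wd /staggered_minor /lagged_casoratian /casoratian addrK.
by split; first exact: mulf_neq0; field; rewrite ?p1 ?q0 ?q1 ?q2.
Qed.

Lemma divf_common (c x y : F) : c != 0 -> (x / c) / (y / c) = x / y.
Proof. by move=> c0; rewrite invf_div mulrA divfK. Qed.

Lemma crossing_minors_neq0 (k : nat) : (1 <= k <= N)%N ->
  [/\ D k%:Z != 0, E k%:Z != 0, G k%:Z != 0 & G (k%:Z + 1) != 0].
Proof.
move=> kN; have [w0 nab nac ndc ndb] := crossing_neq kN.
have [c0 ab ac dc db] := crossing_differences kN.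
have n0 (x y z : F) : x != y -> 1 - x / y = z / (P k%:Z * Q (k%:Z + 1)) ->
    z != 0.
  move=> xy h; apply: contraNneq xy => z0; move/eqP: h.
  rewrite z0 mul0r subr_eq0 eq_sym => /eqP h.
  have y0 : y != 0.
    by apply: contra_eq_neq h => ->; rewrite invr0 mulr0 eq_sym oner_eq0.
  by rewrite -(divfK y0 x) h mul1r.
split; [|exact: n0 ndb db|exact: n0 nab ab|].
  by rewrite -oppr_eq0; apply: n0 nac ac.
by rewrite -oppr_eq0; apply: n0 ndc dc.
Qed.

Lemma crossing_shares (k : nat) : (1 <= k <= N)%N ->
  [/\ numer_share (w (g (2 * k - 1)%N)) (w (g (2 * k)%N)) (w (g (2 * k + 1)%N))
        = - D k%:Z / G k%:Z,
      denom_share (w (g (2 * k - 1)%N)) (w (g (2 * k + 2)%N)) (w (g (2 * k)%N))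
        = G k%:Z / E k%:Z,
      denom_share (w (g (2 * k + 2)%N)) (w (g (2 * k - 1)%N))
        (w (g (2 * k + 1)%N)) = G (k%:Z + 1) / D k%:Z &
      numer_share (w (g (2 * k + 2)%N)) (w (g (2 * k + 1)%N)) (w (g (2 * k)%N))
        = - E k%:Z / G (k%:Z + 1)].
Proof.
move=> kN; have [c0 ab ac dc db] := crossing_differences kN.
rewrite /numer_share /denom_share ab ac dc db !divf_common //.
by split=> //; rewrite invrN mulrN ?mulNr ?opprK.
Qed.

(** The segment is shared by crossings j - 1 and j; the staggered minors cancel
    and a Casoratian step remains, with factor b_(j-1) for the odd segment and
    1/b_j = b_(j-1) for the even one. *)
Lemma twist_interior (j : nat) : (1 < j <= N)%N ->
  exp_ydV (twist e g N) w (g (2 * j - 1)%N) = b (j%:Z - 1) ^ e /\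
  exp_ydV (twist e g N) w (g (2 * j)%N) = b (j%:Z - 1) ^ e.
Proof.
case: j => // k kN; have kN1 : (1 <= k <= N)%N by lia.
have kN2 : (1 <= k.+1 <= N)%N by lia.
have [sa sb _ _] := crossing_shares kN2.
have [_ _ sc sd] := crossing_shares kN1.
have [D0 E0 G0 _] := crossing_minors_neq0 kN2.
have [D0' E0' _ _] := crossing_minors_neq0 kN1.
rewrite exp_ydV_twist_odd // exp_ydV_twist_even // succnK kN1 kN2 sa sb.
have -> : (2 * k.+1 = 2 * k + 2)%N by lia.
have -> : (2 * k + 2 - 1 = 2 * k + 1)%N by lia.
rewrite sc sd -!expfzMl.
move: D0 E0 G0.
rewrite intSr addrK (lagged_casoratian_step a_per b_inv _ P_rec Q_rec)
  (casoratian_step _ P_rec Q_rec) => D0 E0 G0.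
have bk := rec_coef_neq0 b_inv (k%:Z + 1).
split; congr (_ ^ e); first by field; rewrite ?D0' ?G0.
rewrite -[RHS]mulr1 -(divff bk) mulrA b_inv.
by field; rewrite oppr_eq0 bk E0' G0.
Qed.

Lemma twist_ends : (0 < N)%N ->
  [/\ exp_ydV (twist e g N) w (g 1%N) = (- D 1 / G 1) ^ e,
      exp_ydV (twist e g N) w (g 2%N) = (G 1 / E 1) ^ e,
      exp_ydV (twist e g N) w (g (2 * N + 1)%N)
        = (G (N%:Z + 1) / D N%:Z) ^ e &
      exp_ydV (twist e g N) w (g (2 * N + 2)%N)
        = (- E N%:Z / G (N%:Z + 1)) ^ e].
Proof.
move=> N0; have N1 : (1 <= 1 <= N)%N by []; have NN : (1 <= N <= N)%N by lia.
have [sa sb _ _] := crossing_shares N1; have [_ _ sc sd] := crossing_shares NN.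
have eo := exp_ydV_twist_odd e N w g_inj.
have ee := exp_ydV_twist_even e N w g_inj.
split.
- by rewrite (eo 1%N) // N1 sa mulr1.
- by rewrite (ee 1%N) // N1 sb mulr1.
- have -> : (2 * N + 1 = 2 * N.+1 - 1)%N by lia.
  rewrite (eo N.+1) // succnK NN ltnn mul1r.
  have -> : (2 * N.+1 = 2 * N + 2)%N by lia.
  have -> : (2 * N + 2 - 1 = 2 * N + 1)%N by lia.
  by rewrite sc.
- have -> : (2 * N + 2 = 2 * N.+1)%N by lia.
  rewrite (ee N.+1) // succnK NN ltnn mul1r.
  have -> : (2 * N.+1 = 2 * N + 2)%N by lia.
  have -> : (2 * N + 2 - 1 = 2 * N + 1)%N by lia.
  by rewrite sd.
Qed.

End TwistRegion.

(** * Algebra of the closing condition *)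

(** Here b0 = M^-2 and b1 = M^2.  The vertical region enters through beta = B_n,
    u = B_(n-1), r = B_(n+1) and the tildes v, r' of the last two; the
    horizontal one through B'_m = p' * gamma and its tilde p * gamma, and
    through U = B'_(m-1), R = B'_(m+1) with tildes W, R'.  The other variables
    are values of P, Q at indices 0, 1, 2, n, n + 1, n + 2 (Pn1 is P_(n+1)). *)
Section ClosingUp.
Variables (F : fieldType) (b0 b1 u v r r' beta p p' : F).
Variables (gamma U W R R' : F).
Variables (P0 P1 Q1 Q2 Pn Pn1 Qn1 Qn2 : F).
Hypothesis b01 : b0 * b1 = 1.
Hypothesis det : v * r = beta * beta + b0.
Hypothesis det' : u * r' = beta * beta + b1.
Hypotheses (pE : p = r - u) (p'E : p' = r' - v).
Hypotheses (PnE : Pn = beta * P1 + b1 * v * P0)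
           (Pn1E : Pn1 = r * P1 + b1 * beta * P0)
           (Qn1E : Qn1 = beta * Q2 + b0 * u * Q1)
           (Qn2E : Qn2 = r' * Q2 + b0 * beta * Q1).

(** The left-hand sides are the minors of P', Q' at the ends of the horizontal
    region: staggered, Casoratian and lagged at 1, and, up to the factor -c c' of
    closing_up, staggered at m + 1.  The third equality comes from transporting
    P_0 and Q_2 back from the far end of the vertical region, by the inverse of
    its transfer matrix. *)
Lemma corner_minors s (rE : r = s * beta + b0 * u)
    (r'E : r' = s * beta + b1 * v) :
  [/\ P0 * Qn2 - Pn * Q2 = beta * (P0 * (s * Q2 + b0 * Q1) - P1 * Q2),
      P0 * Qn2 - (p' * P0 + b0 * Pn) * Q2 = - b0 * beta * (P1 * Q2 - P0 * Q1),
      Pn * (p * Qn2 + b1 * Q2) - P0 * Qn2 = beta * (Pn1 * Qn2 - Pn * Qn1) &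
      P1 * Qn1 - Pn1 * Q1 = beta * (P1 * Q2 - (s * P1 + b1 * P0) * Q1)].
Proof.
split; first by rewrite Qn2E PnE r'E; ring.
- by rewrite Qn2E PnE p'E r'E; ring: b01.
- have -> : P0 = r * Pn - beta * Pn1.
    by rewrite PnE Pn1E; ring: det b01.
  have -> : b1 * Q2 = u * Qn2 - beta * Qn1.
    by rewrite Qn2E Qn1E; ring: det' b01.
  by rewrite pE; ring.
- by rewrite Qn1E Pn1E rE; ring.
Qed.

Hypotheses (RE : R = p * (p' * gamma) + b1 * U)
           (R'E : R' = p' * (p * gamma) + b0 * W)
           (RR' : R - R' = (b1 - b0) * gamma)
           (WR : W * R = p' * gamma * (p * gamma) + b1).
Hypothesis longitude : R + p * gamma * v = 0.

(** The equation of Lambda is invariant under M |-> 1/M: by the determinant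
    relations p' u - p v = b1 - b0, and R - R' is gamma times this number. *)
Lemma longitude_tilde : R' + p' * gamma * u = 0.
Proof.
have -> : R' = R - (b1 - b0) * gamma by rewrite -RR'; ring.
have -> : R = - (p * gamma * v) by apply/eqP; rewrite -addr_eq0 longitude.
by rewrite pE p'E; ring: det det'.
Qed.

(** By the equation of Lambda and its tilde, the coefficients of the horizontal
    transfer matrix are proportional to those of the vertical relations
    P_n - b1 v P_0 = beta P_1 and P_0 - r P_n = - beta P_(n+1), and to those of
    their analogues for Q.  Hence one value of P or Q is left on each line. *)
Lemma closing_up (c := p * gamma * b0 * beta) (c' := p' * gamma * beta) :
  [/\ p' * gamma * P0 + b0 * W * Pn = - c' * Pn1,
      R * P0 + b0 * (p * gamma) * Pn = c * P1,
      p * gamma * Qn2 + b1 * U * Q2 = c * Q1,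
      R' * Qn2 + b1 * (p' * gamma) * Q2 = - c' * Qn1 &
      c * c' = b0].
Proof.
have RE' : R = - (p * gamma * v) by apply/eqP; rewrite -addr_eq0 longitude.
have R'E' : R' = - (p' * gamma * u).
  by apply/eqP; rewrite -addr_eq0 longitude_tilde.
have bW : b0 * W = - (p' * gamma * r).
  have -> : b0 * W = R' - p' * (p * gamma) by rewrite R'E; ring.
  by rewrite R'E' pE; ring.
have bU : b1 * U = - (p * gamma * r').
  have -> : b1 * U = R - p * (p' * gamma) by rewrite RE; ring.
  by rewrite RE' p'E; ring.
(* The horizontal determinant relation fixes the product of the two scalars. *)
have one : p * p' * gamma * gamma * beta * beta = 1.
  have : b0 * (W * R) = b0 * b1 + b0 * (p' * gamma * (p * gamma)).
    by rewrite WR; ring.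
  rewrite mulrA bW RE' b01 => h.
  transitivity (- (p' * gamma * r) * - (p * gamma * v)
                - b0 * (p' * gamma * (p * gamma))).
    by ring: det.
  by rewrite h; ring.
rewrite bW bU RE' R'E' PnE Pn1E Qn1E Qn2E /c /c'; split.
- by ring: det b01.
- by ring: b01.
- by ring.
- by ring: det' b01.
- transitivity (b0 * (p * p' * gamma * gamma * beta * beta)); first by ring.
  by rewrite one mulr1.
Qed.

End ClosingUp.

(** * The sequences of the double twist knot *)

Section TwistKnotSequences.
Variable F : fieldType.
Variables (s M : F) (n m : nat).
Hypothesis M_neq0 : M != 0.
Hypotheses (n_even : ~~ odd n) (m_even : ~~ odd m).

Lemma oddz_succ j : oddz (j + 1) = ~~ oddz j.
Proof.
rewrite /oddz; case: j => [k|k]; first by rewrite -intSr.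
have -> : Negz k + 1 = - k%:Z by rewrite NegzE intSr opprD subrK.
by rewrite abszN /= negbK.
Qed.

Lemma B_b_inv j : B_b M j * B_b M (j + 1) = 1.
Proof.
rewrite /B_b oddz_succ; have M2 : M ^+ 2 != 0 by rewrite expf_neq0.
by case: oddz; rewrite /= ?divff ?mulVf.
Qed.

Lemma B'_b_inv j : B'_b M j * B'_b M (j + 1) = 1.
Proof.
rewrite /B'_b oddz_succ; have M2 : M ^+ 2 != 0 by rewrite expf_neq0.
by case: oddz; rewrite /= ?divff ?mulVf.
Qed.

Lemma B'_a_per j : B'_a s n M (j + 1 + 1) = B'_a s n M j.
Proof. by rewrite /B'_a !oddz_succ negbK. Qed.

Lemma tilde_B j : tilde (fun M => B_seq s M j) M =
  fund (shift (B_a s)) (shift (B_b M)) j.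
Proof.
apply/esym/(rec_sol_ext (shift_inv B_b_inv)) => // i.
by rewrite /shift /B_b oddz_succ exprVn invrK; case: oddz.
Qed.

Lemma tilde_B' j : tilde (fun M => B'_seq s n M j) M =
  fund (shift (B'_a s n M)) (shift (B'_b M)) j.
Proof.
apply/esym/(rec_sol_ext (shift_inv B'_b_inv)) => i.
  by rewrite /shift /B'_a oddz_succ /tilde invrK; case: oddz.
by rewrite /shift /B'_b oddz_succ exprVn invrK; case: oddz.
Qed.

Lemma B_b_expz (j : nat) : (0 < j)%N ->
  B_b M (j%:Z - 1) = M ^ (2 * (- 1) ^+ j).
Proof.
case: j => // j _; rewrite intSr addrK /B_b /oddz -[in RHS]signr_odd /=.
by case: (odd j).
Qed.

Lemma B'_bV j : (B'_b M j)^-1 = B_b M j.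
Proof. by rewrite /B'_b /B_b; case: oddz; rewrite ?invrK. Qed.

Variables z1 z2 z3 : F.
Local Notation P := (P_seq s M z1 z2 z3).
Local Notation Q := (Q_seq s M z2 z3).
Local Notation P' := (P'_seq s n M z1 z2 z3).
Local Notation Q' := (Q'_seq s n M z2 z3).

Lemma P_rec : satisfies_rec (B_a s) (B_b M) P.
Proof. exact/rec_solP/(rec_coef_neq0 B_b_inv). Qed.

Lemma Q_rec : satisfies_rec (B_a s) (B_b M) Q.
Proof. exact/rec_solP/(rec_coef_neq0 B_b_inv). Qed.

Lemma P'_rec : satisfies_rec (B'_a s n M) (B'_b M) P'.
Proof. exact/rec_solP/(rec_coef_neq0 B'_b_inv). Qed.

Lemma Q'_rec : satisfies_rec (B'_a s n M) (B'_b M) Q'.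
Proof. exact/rec_solP/(rec_coef_neq0 B'_b_inv). Qed.

Hypothesis longitude :
  B'_seq s n M (m%:Z + 1)
  + tilde (fun M => B'_seq s n M m%:Z) M
    * tilde (fun M => B_seq s M (n%:Z - 1)) M = 0.

(** The factor beta is B_n.  It divides c; the implication beta = 0 -> c = 0 is
    what is needed to deduce that beta is nonzero from Q'_(m+1) <> 0. *)
Lemma corner_relations : exists beta c c',
  [/\ staggered_minor P' Q' 1 = beta * lagged_casoratian P Q 1,
      casoratian P' Q' 1 = - B_b M 0 * beta * staggered_minor P Q 1,
      lagged_casoratian P' Q' 1 = beta * staggered_minor P Q (n%:Z + 1),
      P 1 * Q (n%:Z + 1) - P (n%:Z + 1) * Q 1 = beta * casoratian P Q 1 &
      (beta = 0 -> c = 0)] /\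
  [/\ P' m%:Z = - c' * P (n%:Z + 1), P' (m%:Z + 1) = c * P 1,
      Q' (m%:Z + 1) = c * Q 1, Q' (m%:Z + 2) = - c' * Q (n%:Z + 1) &
      c * c' = B_b M 0].
Proof.
have [k nE] : exists k, n = k.*2 by exists n./2; rewrite even_halfK.
have [l mE] : exists l, m = l.*2 by exists m./2; rewrite even_halfK.
set b0 := B_b M 0; set b1 := B_b M 1.
have b01 : b0 * b1 = 1 by apply: B_b_inv 0.
pose K := fund (B_a s) (B_b M); pose K' := fund (shift (B_a s)) (shift (B_b M)).
pose L := fund (B'_a s n M) (B'_b M).
pose L' := fund (shift (B'_a s n M)) (shift (B'_b M)).
have s_per : forall j, B_a s (j + 1 + 1) = B_a s j by [].
have [beta [Kn K'n]] : exists beta, K n%:Z = beta /\ K' n%:Z = beta.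
  have [h [e1 e2 _]] := fund_even s_per B_b_inv k.
  by exists (s * h); rewrite nE.
have det : K' (n%:Z - 1) * K (n%:Z + 1) = beta * beta + b0.
  by rewrite -{1}Kn -K'n nE; apply/fund_det/B_b_inv.
have det' : K (n%:Z - 1) * K' (n%:Z + 1) = beta * beta + b1.
  have := @fund_det _ (shift (B_a s)) _ (shift_inv B_b_inv) k.
  by rewrite -/K' -nE !(fund_shift2 s_per B_b_inv) -/K Kn K'n.
have bn : B_b M n%:Z = b0.
  by rewrite nE -(addr0 k.*2%:Z) per_double //; apply: rec_coef_per B_b_inv.
have bn1 : B_b M (n%:Z + 1) = b1.
  by rewrite nE per_double //; apply: rec_coef_per B_b_inv.
have K_rec : satisfies_rec (B_a s) (B_b M) K by apply: fund_rec B_b_inv.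
have K'_rec : satisfies_rec (shift (B_a s)) (shift (B_b M)) K'.
  exact: fund_shift_rec B_b_inv.
have rE : K (n%:Z + 1) = s * beta + b0 * K (n%:Z - 1).
  by rewrite K_rec Kn bn.
have r'E : K' (n%:Z + 1) = s * beta + b1 * K' (n%:Z - 1).
  by rewrite K'_rec K'n {2}/shift bn1.
have [PnE Pn1E _ _] := rec_block s_per B_b_inv n P_rec.
have [_ _ Qn1E Qn2E] := rec_block s_per B_b_inv n Q_rec.
rewrite -/K -/K' -/b0 -/b1 Kn K'n in PnE Pn1E Qn1E Qn2E.
pose p := B'_a s n M 0; pose p' := B'_a s n M 1.
have pE : p = K (n%:Z + 1) - K (n%:Z - 1) by [].
have p'E : p' = K' (n%:Z + 1) - K' (n%:Z - 1) by rewrite /p' /B'_a /= !tilde_B.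
have b'0 : B'_b M 0 = b1 by [].
have b'1 : B'_b M 1 = b0 by [].
have [gamma [Lm L'm LL']] := fund_even B'_a_per B'_b_inv l.
rewrite -/L -/L' -mE -/p -/p' b'0 b'1 in Lm L'm LL'.
have am : B'_a s n M m%:Z = p.
  by rewrite mE -(addr0 l.*2%:Z) per_double //; apply: B'_a_per.
have am1 : B'_a s n M (m%:Z + 1) = p'.
  by rewrite mE per_double //; apply: B'_a_per.
have bm : B'_b M m%:Z = b1.
  by rewrite mE -(addr0 l.*2%:Z) per_double //; apply: rec_coef_per B'_b_inv.
have bm1 : B'_b M (m%:Z + 1) = b0.
  by rewrite mE per_double //; apply: rec_coef_per B'_b_inv.
have L_rec : satisfies_rec (B'_a s n M) (B'_b M) L by apply: fund_rec B'_b_inv.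
have L'_rec : satisfies_rec (shift (B'_a s n M)) (shift (B'_b M)) L'.
  exact: fund_shift_rec B'_b_inv.
have RE : L (m%:Z + 1) = p * (p' * gamma) + b1 * L (m%:Z - 1).
  by rewrite L_rec Lm bm am.
have R'E : L' (m%:Z + 1) = p' * (p * gamma) + b0 * L' (m%:Z - 1).
  by rewrite L'_rec L'm /shift bm1 am1.
have WR : L' (m%:Z - 1) * L (m%:Z + 1) = p' * gamma * (p * gamma) + b1.
  by rewrite -{1}Lm -L'm mE; apply: fund_det B'_b_inv l.
have lon : L (m%:Z + 1) + p * gamma * K' (n%:Z - 1) = 0.
  by rewrite -longitude tilde_B tilde_B' -/L' L'm.
have P'0 : P' 0 = P n%:Z by apply: rec_sol_k.
have P'1 : P' 1 = P 0 by apply: (rec_sol_k1 _ _ 0).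
have Q'1 : Q' 1 = Q 2 by apply: rec_sol_k.
have Q'2 : Q' 2 = Q (n%:Z + 2) by apply: (rec_sol_k1 _ _ 1).
have [P'm P'm1 _ _] := rec_block B'_a_per B'_b_inv m P'_rec.
have [_ _ Q'm1 Q'm2] := rec_block B'_a_per B'_b_inv m Q'_rec.
rewrite -/L -/L' b'0 b'1 Lm L'm ?P'0 ?P'1 ?Q'1 ?Q'2 in P'm P'm1 Q'm1 Q'm2.
have P'2 : P' 2 = p' * P 0 + b0 * P n%:Z by rewrite (P'_rec 1) P'1 P'0.
have Q'3 : Q' 3 = p * Q (n%:Z + 2) + b1 * Q 2.
  by rewrite (Q'_rec 2) Q'1 Q'2; congr (_ * _ + _).
have Q3 : Q 3 = s * Q 2 + b0 * Q 1 by rewrite (Q_rec 2).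
have P2 : P 2 = s * P 1 + b1 * P 0 by rewrite (P_rec 1).
have [c1 c2 c3 c4] :=
  corner_minors b01 det det' pE p'E PnE Pn1E Qn1E Qn2E rE r'E.
have [d1 d2 d3 d4 d5] :=
  closing_up b01 det det' pE p'E PnE Pn1E Qn1E Qn2E RE R'E LL' WR lon.
exists beta, (p * gamma * b0 * beta), (p' * gamma * beta); split; last first.
  by split; rewrite // ?P'm ?P'm1 ?Q'm1 ?Q'm2.
rewrite /staggered_minor /casoratian /lagged_casoratian.
rewrite -[1 + 1 + 1]/(3%:Z) -[1 + 1]/(2%:Z) subrr addrK.
have -> : n%:Z + 1 + 1 = n%:Z + 2 by rewrite -addrA.
rewrite P'1 P'0 Q'2 Q'1 P'2 Q'3 Q3 P2.
by split=> // ->; rewrite mulr0.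
Qed.

End TwistKnotSequences.

(** * The deformed solution *)

Lemma crossing_index_cases N j : (1 <= j <= N + 1)%N ->
  [\/ j = 1, j = N.+1 | 1 < j <= N]%N.
Proof.
move=> jN; have [->|j1] := eqVneq j 1%N; first by constructor 1.
by have [->|jN1] := eqVneq j N.+1; [constructor 2 | constructor 3; lia].
Qed.

Lemma odd_label_succ i : (2 * i + 1 = 2 * i.+1 - 1)%N.
Proof. lia. Qed.

Lemma even_label_succ i : (2 * i + 2 = 2 * i.+1)%N.
Proof. lia. Qed.

Section TwistKnot.
Variables (n m : nat).
Hypotheses (n_gt0 : (0 < n)%N) (m_gt0 : (0 < m)%N).

Lemma zseg_inj : injective zseg.
Proof. by move=> i j []. Qed.

(** The labels z'_1, z'_2, z'_(2m+1), z'_(2m+2) name corner segments, every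
    other one an interior segment of the horizontal region. *)
Lemma z'segP i :
  [\/ i = 1 /\ z'seg n m i = zseg (2 * n + 1),
      i = 2 /\ z'seg n m i = zseg 1,
      i = 2 * m + 1 /\ z'seg n m i = zseg (2 * n + 2) |
      i = 2 * m + 2 /\ z'seg n m i = zseg 2 \/
      [/\ i <> 1, i <> 2, i <> 2 * m + 1, i <> 2 * m + 2 &
          z'seg n m i = inr i]]%N.
Proof.
rewrite /z'seg; case: eqP => [->|i1]; first by constructor 1.
case: eqP => [->|i2]; first by constructor 2.
case: eqP => [->|i3]; first by constructor 3.
by case: eqP => [->|i4]; constructor 4; by [left | right].
Qed.

Lemma z'seg_inj : injective (z'seg n m).
Proof.
move=> i j.
case: (z'segP i) => [[-> ->]|[-> ->]|[-> ->]|[[-> ->]|[? ? ? ? ->]]];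
  case: (z'segP j) => [[-> ->]|[-> ->]|[-> ->]|[[-> ->]|[? ? ? ? ->]]] //;
  by case; lia.
Qed.

Lemma assignment_z'seg (F : fieldType) (z z' : nat -> F) i :
  consistent n m z z' -> assignment z z' (z'seg n m i) = z' i.
Proof.
case=> c1 c2 c3 c4.
by case: (z'segP i) => [[-> ->]|[-> ->]|[-> ->]|[[-> ->]|[_ _ _ _ ->]]].
Qed.

Lemma z'seg_corner_odd : z'seg n m (2 * m + 1) = zseg (2 * n + 2).
Proof. by case: (z'segP (2 * m + 1)%N) => [[]|[]|[]|[[]|[]]] //; lia. Qed.

Lemma z'seg_corner_even : z'seg n m (2 * m + 2) = zseg 2.
Proof. by case: (z'segP (2 * m + 2)%N) => [[]|[]|[]|[[]|[]]] //; lia. Qed.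

Lemma vertical_interior i j : (1 < j <= n)%N ->
  zseg (2 * j - 1) != z'seg n m i /\ zseg (2 * j) != z'seg n m i.
Proof.
move=> jn; split; apply/eqP;
  by case: (z'segP i) => [[_ ->]|[_ ->]|[_ ->]|[[_ ->]|[_ _ _ _ ->]]] //;
    case; lia.
Qed.

Lemma horizontal_interior i j : (1 < j <= m)%N ->
  z'seg n m (2 * j - 1) != zseg i /\ z'seg n m (2 * j) != zseg i.
Proof.
move=> jm; split; apply/eqP.
  by case: (z'segP (2 * j - 1)) => [[? _]|[? _]|[? _]|[[? _]|[_ _ _ _ ->]]] //;
    lia.
by case: (z'segP (2 * j)) => [[? _]|[? _]|[? _]|[[? _]|[_ _ _ _ ->]]] //; lia.
Qed.

Lemma nondegenerate_cat (F : fieldType) (V W : dilog_sum) (w : segment -> F) :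
  nondegenerate_assignment (V ++ W) w ->
  nondegenerate_assignment V w /\ nondegenerate_assignment W w.
Proof.
by move=> VW; split=> e a b ab; apply: (VW e); rewrite mem_cat ab ?orbT.
Qed.

End TwistKnot.

(** Over any field, with s the chosen root of Lambda: the interior equations
    come from twist_interior, and in a corner equation the relations of
    corner_relations leave a single factor M^-2. *)
Lemma twist_knot_solution (F : fieldType) (n m : nat)
    (n_gt0 : (0 < n)%N) (n_even : ~~ odd n)
    (m_gt0 : (0 < m)%N) (m_even : ~~ odd m)
    (s M : F) (M_neq0 : M != 0)
    (longitude :
       B'_seq s n M (m%:Z + 1)
       + tilde (fun M => B'_seq s n M m%:Z) M
         * tilde (fun M => B_seq s M (n%:Z - 1)) M = 0)
    (z1 z2 z3 : F) (z z' : nat -> F) :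
  let P := P_seq s M z1 z2 z3 in
  let Q := Q_seq s M z2 z3 in
  let P' := P'_seq s n M z1 z2 z3 in
  let Q' := Q'_seq s n M z2 z3 in
  (forall j : nat, (1 <= j <= n + 2)%N -> Q j%:Z != 0) ->
  (forall j : nat, (1 <= j <= m + 2)%N -> Q' j%:Z != 0) ->
  (forall j : nat, (1 <= j <= n + 1)%N ->
     z (2 * j - 1)%N = P (j%:Z - 1) / Q (j%:Z + 1) /\
     z (2 * j)%N = P j%:Z / Q j%:Z) ->
  (forall j : nat, (1 <= j <= m + 1)%N ->
     z' (2 * j - 1)%N = P' (j%:Z - 1) / Q' (j%:Z + 1) /\
     z' (2 * j)%N = P' j%:Z / Q' j%:Z) ->
  nondegenerate_assignment (potential n m) (assignment z z') ->
  deformed_solution n m M z z'.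
Proof.
move=> P Q P' Q' Q0 Q'0 zE z'E nd.
have [beta [c [c' [[G'1 E'1 D'1 PQ beta0] [P'm P'm1 Q'm1 Q'm2 cc']]]]] :=
  corner_relations M_neq0 n_even m_even z1 z2 z3 longitude.
rewrite -/P -/Q -/P' -/Q' in G'1 E'1 D'1 PQ P'm P'm1 Q'm1 Q'm2.
(* Both scalars, and B_n, are nonzero because Q' does not vanish at the far end
   of the horizontal region. *)
have c0 : c != 0.
  have := Q'0 m.+1; rewrite intSr Q'm1 addn2 leqnSn => /(_ isT).
  by rewrite mulf_eq0 negb_or => /andP[].
have c'0 : c' != 0.
  have := Q'0 m.+2; rewrite !intSr -addrA Q'm2 addn2 leqnn => /(_ isT).
  by rewrite mulf_eq0 oppr_eq0 negb_or => /andP[].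
have beta_neq0 : beta != 0 by apply: contraNneq c0 => /beta0/eqP.
have cons : consistent n m z z'.
  have v1 : (1 <= 1 <= n + 1)%N by rewrite addn1.
  have v2 : (1 <= n.+1 <= n + 1)%N by rewrite addn1 leqnn.
  have h1 : (1 <= 1 <= m + 1)%N by rewrite addn1.
  have h2 : (1 <= m.+1 <= m + 1)%N by rewrite addn1 leqnn.
  have [e1 e2] := zE _ v1; have [e3 e4] := zE _ v2.
  have [f1 f2] := z'E _ h1; have [f3 f4] := z'E _ h2.
  split.
  - by rewrite odd_label_succ f1 e3 (intSr n) addrK -addrA subrr.
  - by rewrite f2 e1 subrr.
  - rewrite odd_label_succ even_label_succ f3 e4 (intSr n) (intSr m) addrK.
    by rewrite -addrA P'm Q'm2 -mulf_div divff ?oppr_eq0 // mul1r.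
  - rewrite even_label_succ f4 e2 (intSr m) P'm1 Q'm1.
    by rewrite -mulf_div divff // mul1r.
have w'E i := assignment_z'seg i cons.
set w := assignment z z' in nd w'E *.
have [ndv ndh] := nondegenerate_cat nd.
have B_per : forall j, B_a s (j + 1 + 1) = B_a s j by [].
have B'_per := B'_a_per s M n.
have bV := B_b_inv M_neq0; have b'V := B'_b_inv M_neq0.
have Pr := P_rec s M_neq0 z1 z2 z3; have Qr := Q_rec s M_neq0 z2 z3.
have P'r := P'_rec s n M_neq0 z1 z2 z3; have Q'r := Q'_rec s n M_neq0 z2 z3.
have w'z' j : (1 <= j <= m + 1)%N ->
    w (z'seg n m (2 * j - 1)%N) = P' (j%:Z - 1) / Q' (j%:Z + 1) /\
    w (z'seg n m (2 * j)%N) = P' j%:Z / Q' j%:Z by rewrite !w'E; apply: z'E.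
have zi := zseg_inj; have z'i := z'seg_inj n_gt0 m_gt0.
have vint := twist_interior B_per bV Pr Qr zi zE Q0 ndv.
have hint := twist_interior B'_per b'V P'r Q'r z'i w'z' Q'0 ndh.
have [v1 v2 v3 v4] := twist_ends zi zE Q0 ndv n_gt0.
have [h1 h2 h3 h4] := twist_ends z'i w'z' Q'0 ndh m_gt0.
have n_last : (1 <= n <= n)%N by rewrite n_gt0 leqnn.
have [D1 E1 G1 _] := crossing_minors_neq0 zE Q0 ndv (k := 1%N) n_gt0.
have [_ _ _ Gn] := crossing_minors_neq0 zE Q0 ndv n_last.
have := minors_even B_per bV n./2 Pr Qr.
rewrite even_halfK // -/P -/Q => -[Dn En].
have := minors_even B'_per b'V m./2 P'r Q'r.
rewrite even_halfK // -/P' -/Q' => -[D'm E'm].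
have G'm :
    staggered_minor P' Q' (m%:Z + 1) = - B_b M 0 * beta * casoratian P Q 1.
  rewrite /staggered_minor addrK -addrA P'm P'm1 Q'm1 Q'm2.
  by rewrite -[RHS]mulrA -PQ -cc'; ring.
have b'0 : B'_b M 0 = (B_b M 0)^-1 by rewrite -B'_bV invrK.
have b'1 : B'_b M 1 = B_b M 0 by [].
have b1 : B_b M 1 = (B_b M 0)^-1 by rewrite -[RHS]invrK invrK.
have b0 : B_b M 0 != 0 by apply: rec_coef_neq0 bV 0.
set b := B_b M 0 in b0 b'0 b'1 b1 En E'1 G'm.
have s1 : z'seg n m 1 = zseg (2 * n + 1) by [].
have s2 : z'seg n m 2 = zseg 1 by [].
have s3 := z'seg_corner_odd n_gt0 m_gt0.
have s4 := z'seg_corner_even n_gt0 m_gt0.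
(* Each corner takes one end factor from each region, the horizontal one with
   exponent -1. *)
pose k y :=
  exp_ydV (twist 1 zseg n) w y * exp_ydV (twist (- 1) (z'seg n m) m) w y.
have k1 : k (zseg 1) = b.
  rewrite /k v1 -s2 h2 expr1z exprN1 G'1 E'1.
  by field; rewrite ?oppr_eq0 ?b0 ?beta_neq0 ?D1 ?G1.
have k2 : k (zseg 2) = b.
  rewrite /k v2 -s4 h4 expr1z exprN1 G'm E'm b'0 E'1.
  by field; rewrite !(mulN1r, oppr_eq0, mulf_eq0, negb_or) b0 beta_neq0 E1 G1.
have k3 : k (zseg (2 * n + 1)) = b.
  rewrite /k v3 -s1 h1 expr1z exprN1 G'1 D'1 Dn b1.
  field; rewrite !(mulN1r, oppr_eq0, oner_eq0, mulf_eq0, negb_or) /=.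
  by rewrite ?b0 ?beta_neq0 ?D1 ?Gn.
have k4 : k (zseg (2 * n + 2)) = b.
  rewrite /k v4 -s3 h3 expr1z exprN1 D'm b'1 D'1 En G'm.
  field; rewrite !(mulN1r, oppr_eq0, oner_eq0, mulf_eq0, negb_or) /=.
  by rewrite ?b0 ?beta_neq0 ?E1 ?Gn.
have corner N : ~~ odd N -> M ^ (2 * (- 1) ^+ N.+1) = b.
  by move=> Ne; rewrite -signr_odd /= Ne.
split=> // j jN; rewrite /hyperbolicity_equation potential_twist !exp_ydV_cat.
  have [->|->|jn] := crossing_index_cases jN; first by rewrite (corner 0%N).
    by rewrite corner // -odd_label_succ -even_label_succ.
  have [-> ->] := vint j jn.
  have out i := vertical_interior n_gt0 m_gt0 i jn.
  rewrite !exp_ydV_twist_out ?mulr1 => [|i _|i _]; try by have [] := out i.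
  by rewrite expr1z B_b_expz // ltnW //; case/andP: jn.
have [->|->|jm] := crossing_index_cases jN; first by rewrite (corner 0%N).
  by rewrite corner // -odd_label_succ -even_label_succ s3 s4.
have [-> ->] := hint j jm.
have out i := horizontal_interior n_gt0 m_gt0 i jm.
rewrite !exp_ydV_twist_out ?mul1r => [|i _|i _]; try by have [] := out i.
by rewrite exprN1 B'_bV B_b_expz // ltnW //; case/andP: jm.
Qed.

Theorem theorem7p4 (R : realType) (n m : nat)
    (n_gt0 : (0 < n)%N) (n_even : ~~ odd n)
    (m_gt0 : (0 < m)%N) (m_even : ~~ odd m)
    (M Lambda sqrtLambda : R[i])
    (M_neq0 : M != 0) (Lambda_neq0 : Lambda != 0)
    (sqrtLambdaE : sqrtLambda ^+ 2 = Lambda)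
    (Lambda_eq :
       B'_seq sqrtLambda n M (m%:Z + 1)
       + tilde (fun M => B'_seq sqrtLambda n M m%:Z) M
         * tilde (fun M => B_seq sqrtLambda M (n%:Z - 1)) M = 0)
    (z1 z2 z3 : R[i]) (z z' : nat -> R[i]) :
  let P := P_seq sqrtLambda M z1 z2 z3 in
  let Q := Q_seq sqrtLambda M z2 z3 in
  let P' := P'_seq sqrtLambda n M z1 z2 z3 in
  let Q' := Q'_seq sqrtLambda n M z2 z3 in
  (forall j : nat, (1 <= j <= n + 2)%N -> Q j%:Z != 0) ->
  (forall j : nat, (1 <= j <= m + 2)%N -> Q' j%:Z != 0) ->
  (forall j : nat, (1 <= j <= n + 1)%N ->
     z (2 * j - 1)%N = P (j%:Z - 1) / Q (j%:Z + 1) /\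
     z (2 * j)%N = P j%:Z / Q j%:Z) ->
  (forall j : nat, (1 <= j <= m + 1)%N ->
     z' (2 * j - 1)%N = P' (j%:Z - 1) / Q' (j%:Z + 1) /\
     z' (2 * j)%N = P' j%:Z / Q' j%:Z) ->
  nondegenerate_assignment (potential n m) (assignment z z') ->
  deformed_solution n m M z z'.
Proof. exact: twist_knot_solution. Qed.
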